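(* Consider the joint relaying scheme described in the context, with $\mathbf{h}\neq 0$. Let $\mathbf{v}$ be a unit-norm eigenvector of $\mathbf{R}+\mathbf{W}$ for its largest eigenvalue $\lambda_{\max}(\mathbf{R}+\mathbf{W})$, and let $$\mathbf{F}=\gamma\,\frac{\mathbf{h}}{\|\mathbf{h}\|}\,\mathbf{v}^H,$$ where $\gamma\in\mathbb{R}$ is chosen such that $\mathrm{tr}\left(\mathbf{F}(\mathbf{I}+\mathbf{R})\mathbf{F}^H\right)=P_r$. Then the sum-rate achieved with this relaying matrix is $$R_\Sigma(\mathbf{F})=\log_2\left(1+s+\frac{\|\mathbf{h}\|^2\lambda_{\max}(\mathbf{R}+\mathbf{W})\gamma^2}{1+\|\mathbf{h}\|^2\gamma^2}\right).$$
   Context: Data: integers $K,M_r\ge 1$; vectors $\mathbf{h}_r^{(k)}\in\mathbb{C}^{M_r}$, scalars $h_d^{(k)}\in\mathbb{C}$, powers $P^{(k)}\ge 0$, for $k=1,\dots,K$; a vector $\mathbf{h}\in\mathbb{C}^{M_r}$; relay power $P_r>0$. $\|\cdot\|$ is the Euclidean norm (absolute value for scalars), $(\cdot)^H$ the conjugate transpose, $\mathbf{I}$ the identity. For $\mathbf{F}\in\mathbb{C}^{M_r\times M_r}$ put $r=1+\mathbf{h}^H\mathbf{F}\mathbf{F}^H\mathbf{h}$ and $\mathbf{h}_{\mathrm{eff}}^{(k)}=[\,r^{-1/2}\mathbf{h}^H\mathbf{F}\mathbf{h}_r^{(k)},\ h_d^{(k)}]^T\in\mathbb{C}^2$. The sum-rate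 is $$R_\Sigma(\mathbf{F})=\log_2\det\left(\mathbf{I}+\sum_{k=1}^K P^{(k)}\mathbf{h}_{\mathrm{eff}}^{(k)}{\mathbf{h}_{\mathrm{eff}}^{(k)}}^H\right).$$ Moreover $s=\sum_{k=1}^K\|h_d^{(k)}\|^2P^{(k)}$, $\mathbf{R}=\sum_{k=1}^K P^{(k)}\mathbf{h}_r^{(k)}{\mathbf{h}_r^{(k)}}^H$, and $$\mathbf{W}=\tfrac12\sum_{j,k=1}^K P^{(j)}P^{(k)}\left(h_d^{(k)}\mathbf{h}_r^{(j)}-h_d^{(j)}\mathbf{h}_r^{(k)}\right)\left(h_d^{(k)}\mathbf{h}_r^{(j)}-h_d^{(j)}\mathbf{h}_r^{(k)}\right)^H.$$ *)

(* Defs.v *)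
From HB Require Import structures.
From mathcomp Require Import all_boot all_order all_algebra.
From mathcomp Require Import spectral complex.
From mathcomp Require Import reals exp.

Set Implicit Arguments.
Unset Strict Implicit.
Unset Printing Implicit Defensive.
Import Order.TTheory GRing.Theory Num.Theory.

Local Open Scope ring_scope.
Local Open Scope sesquilinear_scope.
Local Open Scope complex_scope.

Section JointRelaying.
Variable R : realType.
Local Notation C := R[i].

Definition log2 (x : R) : R := ln x / ln 2.

(* The norm that the analysis library puts on matrices is the sup norm. *)
Definition enorm n (x : 'cV[C]_n) : R :=
  Num.sqrt (\sum_(i < n) (complex.Re `|x i 0|) ^+ 2).

(* Only used for Hermitian A, all of whose eigenvalues are real. [eigenvalue]
   is defined through row vectors, but A and its transpose have the same
   eigenvalues. *)
Definition largest_eigenvalue n (A : 'M[C]_n) (lam : R) : Prop :=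
  eigenvalue A lam%:C /\ forall mu : R, eigenvalue A mu%:C -> mu <= lam.

Variables (K M : nat).
Variables (hr : 'I_K -> 'cV[C]_M) (hd : 'I_K -> C) (P : 'I_K -> R).

Definition noise_power (h : 'cV[C]_M) (F : 'M[C]_M) : C :=
  1 + (h^t* *m F *m F^t* *m h) 0 0.

(* [noise_power h F] is a real number >= 1, and [sqrtC] is then its
   nonnegative square root. *)
Definition heff (h : 'cV[C]_M) (F : 'M[C]_M) (k : 'I_K) : 'cV[C]_2 :=
  \col_(i < 2) if i == 0
               then (sqrtC (noise_power h F))^-1 * (h^t* *m F *m hr k) 0 0
               else hd k.

Definition rate_mx (h : 'cV[C]_M) (F : 'M[C]_M) : 'M[C]_2 :=
  1%:M + \sum_(k < K) (P k)%:C *: (heff h F k *m (heff h F k)^t*).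

(* The determinant of a Hermitian matrix is real (see [det_rate_mx_real]),
   so [Re] is a mere change of type. *)
Definition sum_rate (h : 'cV[C]_M) (F : 'M[C]_M) : R :=
  log2 (complex.Re (\det (rate_mx h F))).

Definition direct_snr : R := \sum_(k < K) (complex.Re `|hd k|) ^+ 2 * P k.

Definition Rmx : 'M[C]_M := \sum_(k < K) (P k)%:C *: (hr k *m (hr k)^t*).

Definition wvec (j k : 'I_K) : 'cV[C]_M := hd k *: hr j - hd j *: hr k.

Definition Wmx : 'M[C]_M :=
  2^-1 *: \sum_(j < K) \sum_(k < K)
            (P j * P k)%:C *: (wvec j k *m (wvec j k)^t*).

Definition relay_mx (h v : 'cV[C]_M) (gamma : R) : 'M[C]_M :=
  gamma%:C *: (((enorm h)^-1%:C *: h) *m v^t*).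

Lemma det_rate_mx_real (h : 'cV[C]_M) (F : 'M[C]_M) :
  (complex.Re (\det (rate_mx h F)))%:C = \det (rate_mx h F).
Proof.
apply: RRe_real; rewrite CrealE -det_map_mx -det_tr.
suff -> : (map_mx Num.conj (rate_mx h F))^T = rate_mx h F by [].
apply/matrixP=> i j.
rewrite !mxE rmorphD /= rmorph_nat eq_sym; congr (_ + _).
rewrite !summxE rmorph_sum; apply: eq_bigr => k _ /=.
rewrite !(mxE, big_ord_recl, big_ord0) !addr0 !rmorphM /= conjCK.
have hPk : (P k)%:C \is Num.real by apply/complex_realP; exists (P k).
by rewrite (conj_Creal hPk) [_^* * _]mulrC.
Qed.

End JointRelaying.

(* Main.v *)
(* With a_k = v^H h_r^(k), the rank-one relay makes the first entry of h_eff^(k)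
   equal to c r^(-1/2) a_k, where c = gamma ||h|| and r = 1 + c^2. Expanding the
   2x2 determinant gives
     1 + s + (c^2 / r) (A + A s - |B|^2),
     A = sum_k P_k |a_k|^2 = v^H R v,  B = sum_k P_k a_k conj(h_d^(k)),
   and the Lagrange identity turns A s - |B|^2 into v^H W v, so that the last
   bracket is v^H (R + W) v = lambda_max. *)
Require Import Defs.
From mathcomp Require Import all_boot all_order all_algebra.
From mathcomp Require Import spectral complex.
From mathcomp Require Import reals exp ring.
Import Order.TTheory GRing.Theory Num.Theory.
Local Open Scope ring_scope.
Local Open Scope sesquilinear_scope.
Local Open Scope complex_scope.


(** Weighted Lagrange identity. The families [b] and [e] stand for the conjugates of [a] and [d];
    keeping them independent makes this a polynomial identity over any commutative ring. *)
Lemma cauchy_binet_two_rows (A : comNzRingType) (I : finType)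
    (p a b d e : I -> A) :
  \sum_j \sum_k p j * p k * ((d k * a j - d j * a k) * (e k * b j - e j * b k)) =
  2 * ((\sum_k p k * (a k * b k)) * (\sum_k p k * (d k * e k))
       - (\sum_k p k * (a k * e k)) * (\sum_k p k * (d k * b k))).
Proof.
pose S f : A := \sum_k p k * f k.
pose T f g : A := \sum_j \sum_k (p j * f j) * (p k * g k).
have TE f g : T f g = S f * S g.
  by rewrite /S big_distrl; apply: eq_bigr => j _; rewrite big_distrr.
(* The four terms of the expanded product. Each double sum factors by [TE], and exchanging [j] and
   [k] pairs them up, whence the factor 2. *)
transitivity (T (fun k => a k * b k) (fun k => d k * e k)
   - T (fun k => a k * e k) (fun k => d k * b k)
   - T (fun k => d k * b k) (fun k => a k * e k)
   + T (fun k => d k * e k) (fun k => a k * b k)).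
  rewrite /T -!sumrB -big_split; apply: eq_bigr => j _ /=.
  by rewrite -!sumrB -big_split; apply: eq_bigr => k _ /=; ring.
by rewrite !TE /S; ring.
Qed.

Lemma det_mx2 (A : comNzRingType) (X : 'M[A]_2) :
  \det X = X 0 0 * X 1 1 - X 0 1 * X 1 0.
Proof.
rewrite (expand_det_row _ 0) !big_ord_recl big_ord0 addr0 /cofactor.
rewrite !det_mx11 !mxE /= !mul1r expr1 mulN1r mulrN.
by congr (_ * X _ _ - X _ _ * X _ _); apply: val_inj.
Qed.

Section RankOneRelay.
Set Implicit Arguments.
Unset Strict Implicit.
(* Reopened so that [^*] is [Num.conj], as in [^t*], not [conjc]. *)
Local Open Scope ring_scope.
Variable R : realType.
Local Notation C := R[i].

Lemma Re_norm_sqr (z : C) : ((complex.Re `|z|) ^+ 2)%:C = z * z^*.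
Proof.
have e : (complex.Re `|z|)%:C = `|z| by apply/RRe_real/normr_real.
by rewrite -normCK -[in RHS]e rmorphXn.
Qed.

Lemma adjoint_mulmxC m n p (A : 'M[C]_(m, n)) (B : 'M[C]_(m, p)) :
  A^t* *m B = (B^t* *m A)^t*.
Proof.
apply/matrixP => i j; rewrite !mxE rmorph_sum; apply: eq_bigr => k _.
by rewrite !mxE rmorphM /= conjCK mulrC.
Qed.

Lemma enorm_sqr n (x : 'cV[C]_n) : (enorm x ^+ 2)%:C = (x^t* *m x) 0 0.
Proof.
rewrite sqr_sqrtr; last by apply: sumr_ge0 => i _; apply: sqr_ge0.
rewrite mxE rmorph_sum; apply: eq_bigr => i _.
by rewrite [LHS]Re_norm_sqr !mxE mulrC.
Qed.

Lemma conj_real (x : R) : (x%:C : C)^* = x%:C.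
Proof. by apply: conj_Creal; apply/complex_realP; exists x. Qed.

Lemma quad_form_outer n (v u : 'cV[C]_n) :
  (v^t* *m (u *m u^t*) *m v) 0 0 = (v^t* *m u) 0 0 * ((v^t* *m u) 0 0)^*.
Proof.
(* The second factor [u^t* *m v] is the conjugate of the first. *)
by rewrite mulmxA -mulmxA [LHS]mxE big_ord1 (adjoint_mulmxC u v) !mxE.
Qed.

Lemma quad_form_sum (I : finType) n (v : 'cV[C]_n) (p : I -> C) (u : I -> 'M[C]_n) :
  (v^t* *m (\sum_k p k *: u k) *m v) 0 0 =
  \sum_k p k * (v^t* *m u k *m v) 0 0.
Proof.
rewrite mulmx_sumr mulmx_suml summxE; apply: eq_bigr => k _.
by rewrite -scalemxAr -scalemxAl mxE.
Qed.

Variables (K M : nat).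
Variables (hr : 'I_K -> 'cV[C]_M) (hd : 'I_K -> C) (P : 'I_K -> R).

Lemma quad_form_Rmx (v : 'cV[C]_M) :
  (v^t* *m Rmx hr P *m v) 0 0 =
  \sum_k (P k)%:C * ((v^t* *m hr k) 0 0 * ((v^t* *m hr k) 0 0)^*).
Proof.
by rewrite quad_form_sum; apply: eq_bigr => k _; rewrite quad_form_outer.
Qed.

Lemma direct_snr_complex :
  (direct_snr hd P)%:C = \sum_k (P k)%:C * (hd k * (hd k)^*).
Proof.
rewrite rmorph_sum; apply: eq_bigr => k _.
by rewrite mulrC -Re_norm_sqr -rmorphM mulrC.
Qed.

Lemma quad_form_Wmx (v : 'cV[C]_M) (a := fun k => (v^t* *m hr k) 0 0) :
  (v^t* *m Wmx hr hd P *m v) 0 0 =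
  (\sum_k (P k)%:C * (a k * (a k)^*)) * (\sum_k (P k)%:C * (hd k * (hd k)^*))
  - (\sum_k (P k)%:C * (a k * (hd k)^*)) * (\sum_k (P k)%:C * (hd k * (a k)^*)).
Proof.
(* Inserting [2^-1 * 2] on the right matches the one half in [Wmx] with the 2 of the Lagrange
   identity. *)
rewrite -[RHS](mulKf (_ : 2 != 0 :> C)) ?pnatr_eq0 // -cauchy_binet_two_rows.
rewrite -scalemxAr -scalemxAl mxE; congr (_ * _).
rewrite mulmx_sumr mulmx_suml summxE; apply: eq_bigr => j _.
rewrite quad_form_sum; apply: eq_bigr => k _.
have wE : (v^t* *m wvec hr hd j k) 0 0 = hd k * a j - hd j * a k.
  by rewrite /a mulmxBr -!scalemxAr !mxE.
by rewrite quad_form_outer wE rmorphM rmorphB !rmorphM.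
Qed.

(** Besides the noise power, [F] enters [heff] only through the row [h^t* *m F], so the formula is
    stated for any [F] that makes this row a multiple of [v^t*]. *)
Lemma det_rate_mx (h : 'cV[C]_M) (F : 'M[C]_M) (v : 'cV[C]_M) (c : C) :
  h^t* *m F = c *: v^t* ->
  \det (rate_mx hr hd P h F) =
  1 + (direct_snr hd P)%:C
  + c * c^* / (sqrtC (noise_power h F) * (sqrtC (noise_power h F))^*)
    * (v^t* *m (Rmx hr P + Wmx hr hd P) *m v) 0 0.
Proof.
move=> hFE; set q := sqrtC _.
pose a k := (v^t* *m hr k) 0 0.
have e0 k : heff hr hd h F k 0 0 = q^-1 * c * a k.
  by rewrite mxE hFE -scalemxAl mxE mulrA.
have e1 k : heff hr hd h F k 1 0 = hd k by rewrite mxE.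
have entry i j : rate_mx hr hd P h F i j =
    (i == j)%:R + \sum_k (P k)%:C * (heff hr hd h F k i 0 * (heff hr hd h F k j 0)^*).
  rewrite 2!mxE summxE; congr (_ + _); apply: eq_bigr => k _.
  by rewrite mxE mxE big_ord1 !mxE.
rewrite det_mx2 !entry /= mulmxDr mulmxDl [in RHS]mxE.
rewrite quad_form_Rmx quad_form_Wmx direct_snr_complex -/a.
under eq_bigr do rewrite e0.
under [X in _ * (_ + X) - _]eq_bigr do rewrite e1.
under [X in _ - (_ + X) * _]eq_bigr do rewrite e0 e1.
under [X in _ - _ * (_ + X)]eq_bigr do rewrite e0 e1.
set A := \sum_k (P k)%:C * (a k * (a k)^*).
set S := \sum_k (P k)%:C * (hd k * (hd k)^*).
set B := \sum_k (P k)%:C * (a k * (hd k)^*).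
set B' := \sum_k (P k)%:C * (hd k * (a k)^*).
have -> : \sum_k (P k)%:C * (q^-1 * c * a k * (q^-1 * c * a k)^*) =
    c * c^* / (q * q^*) * A.
  rewrite mulr_sumr; apply: eq_bigr => k _.
  by rewrite !rmorphM fmorphV invfM /=; ring.
have -> : \sum_k (P k)%:C * (q^-1 * c * a k * (hd k)^*) = q^-1 * c * B.
  by rewrite mulr_sumr; apply: eq_bigr => k _; ring.
have -> : \sum_k (P k)%:C * (hd k * (q^-1 * c * a k)^*) = (q^-1 * c)^* * B'.
  by rewrite mulr_sumr; apply: eq_bigr => k _; rewrite !rmorphM /=; ring.
by rewrite !rmorphM fmorphV invfM /=; ring.
Qed.

Lemma adj_mul_relay_mx (h v : 'cV[C]_M) (gamma : R) :
  h^t* *m relay_mx h v gamma = (enorm h * gamma)%:C *: v^t*.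
Proof.
(* If the norm vanishes, the convention [0^-1 = 0] makes [relay_mx] zero, and both sides are
   zero. *)
have [n0|n0] := eqVneq (enorm h) 0.
  by rewrite /relay_mx n0 invr0 !scale0r mul0mx scaler0 mulmx0 mul0r scale0r.
rewrite /relay_mx -scalemxAr -scalemxAl -scalemxAr mulmxA.
rewrite [h^t* *m h]mx11_scalar -enorm_sqr mul_scalar_mx !scalerA -!rmorphM.
by congr (_%:C *: _); field.
Qed.

Lemma noise_power_relay_mx (h v : 'cV[C]_M) (gamma : R) : enorm v = 1 ->
  noise_power h (relay_mx h v gamma) = (1 + enorm h ^+ 2 * gamma ^+ 2)%:C.
Proof.
(* [F^t* *m h] is the adjoint of [h^t* *m F], so the previous lemma gives both factors. *)
move=> v1; rewrite /noise_power -mulmxA (adjoint_mulmxC _ h) adj_mul_relay_mx.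
have -> : ((enorm h * gamma)%:C *: v^t*)^t* = (enorm h * gamma)%:C *: v.
  by apply/matrixP => i j; rewrite !mxE rmorphM /= conjCK conj_real.
rewrite -scalemxAr -scalemxAl scalerA mxE -enorm_sqr v1 expr1n mulr1.
by rewrite -rmorphM -exprMn rmorphD rmorph1 expr2.
Qed.

End RankOneRelay.

Theorem mainTheorem3 (R : realType) (K M : nat) (hK : (1 <= K)%N) (hM : (1 <= M)%N)
    (hr : 'I_K -> 'cV[R[i]]_M) (hd : 'I_K -> R[i]) (P : 'I_K -> R)
    (hP : forall k, 0 <= P k) (h : 'cV[R[i]]_M) (Pr : R) (hPr : 0 < Pr)
    (hh : h != 0)
    (lam : R) (hlam : largest_eigenvalue (Rmx hr P + Wmx hr hd P) lam)
    (v : 'cV[R[i]]_M) (hv1 : enorm v = 1)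
    (hv : (Rmx hr P + Wmx hr hd P) *m v = lam%:C *: v)
    (gamma : R) (F : 'M[R[i]]_M) (hF : F = relay_mx h v gamma)
    (hgamma : \tr (F *m (1%:M + Rmx hr P) *m F^t*) = Pr%:C) :
  sum_rate hr hd P h F =
    log2 (1 + direct_snr hd P
          + (enorm h ^+ 2 * lam * gamma ^+ 2) / (1 + enorm h ^+ 2 * gamma ^+ 2)).
Proof.
rewrite /sum_rate hF; congr (log2 _).
set r := 1 + enorm h ^+ 2 * gamma ^+ 2.
have r_ge0 : 0 <= r by rewrite addr_ge0 // mulr_ge0 ?sqr_ge0.
rewrite (det_rate_mx _ _ _ (adj_mul_relay_mx h v gamma)).
rewrite noise_power_relay_mx // -/r.
have rC_ge0 : 0 <= r%:C by rewrite ler0c.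
(* Since the root q of r is nonnegative, q q^* = |q|^2 = q^2 = r. *)
rewrite [X in _ / X]mulrC -normCKC ger0_norm ?sqrtC_ge0 // sqrtCK.
(* The eigenvector equation and [enorm v = 1] reduce the quadratic form to [lam]. *)
rewrite conj_real -mulmxA hv -scalemxAr [X in _ + _ * X]mxE -enorm_sqr hv1.
(* Gathering everything under a single embedding of the reals lets [Re] compute. *)
rewrite expr1n mulr1 -!rmorphM -fmorphV -!rmorphM -(rmorph1 (real_complex R)).
rewrite -!rmorphD /=; congr (_ + _); ring.
Qed.
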